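(* For each integer $k\ge3$, there are infinitely many connected unweighted signed graphs $\hat G$ such that the underlying unsigned graph has maximum degree $k$, $\hat G$ has exactly one edge of negative weight, and $\hat G$ contains a sedentary plus state. In particular, there are infinitely many unweighted signed trees $\hat T$ such that the underlying tree has maximum degree three, $\hat T$ has exactly one negative edge weight, and $\hat T$ contains a sedentary plus state.
   Context: An unweighted signed graph has all edge weights in $\{1,-1\}$; its underlying graph replaces all weights by $1$. Its adjacency matrix $A$ has entries the edge weights, and $U(t)=\exp(itA)$. A unit vector $\mathbf u$ is sedentary if for some $0<C\le1$, $\inf_{t>0}|\mathbf u^*U(t)\mathbf u|\ge C$. A plus state is $\frac1{\sqrt2}(\mathbf e_a+\mathbf e_b)$ with $a\ne b$ vertices. *)

(* Defs.v *)
From HB Require Import structures.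
From mathcomp Require Import all_boot all_order all_algebra.
From mathcomp Require Import all_classical all_reals all_analysis.
From mathcomp Require Import complex.
Set Implicit Arguments.
Unset Strict Implicit.
Unset Printing Implicit Defensive.
Import Order.TTheory GRing.Theory Num.Theory.
Import numFieldNormedType.Exports.
Local Open Scope complex_scope.
Local Open Scope ring_scope.

(* Weight 0 encodes a non-edge. *)
Record signed_graph := SignedGraph {
  nvert : nat;
  weight : 'I_nvert -> 'I_nvert -> int;
  weight_sym : forall a b, weight a b = weight b a;
  weight_loopless : forall a, weight a a = 0;
  weight_unit : forall a b, weight a b \in [:: 0; 1; -1]
}.

Arguments weight : clear implicits.

Definition underlying (G : signed_graph) : rel 'I_(nvert G) :=
  fun a b => weight G a b != 0.
Arguments underlying : clear implicits.

Definition sg_isomorphic (G H : signed_graph) : Prop :=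
  exists2 f : 'I_(nvert G) -> 'I_(nvert H),
    bijective f & forall a b, weight H (f a) (f b) = weight G a b.

(* Finite graphs are counted up to isomorphism. *)
Definition infinitely_many (P : signed_graph -> Prop) : Prop :=
  exists G : nat -> signed_graph,
    (forall i, P (G i)) /\ (forall i j, i != j -> ~ sg_isomorphic (G i) (G j)).

Definition max_degree (V : finType) (e : rel V) : nat :=
  (\max_(a : V) #|[set b | e a b]|)%N.

Definition connected_graph (V : finType) (e : rel V) : Prop :=
  (0 < #|V|)%N /\ forall a b : V, connect e a b.

(* [ucycle] accepts the back-and-forth walk a, b, hence the size bound. *)
Definition acyclic (V : finType) (e : rel V) : Prop :=
  forall c : seq V, ucycle e c -> (size c <= 2)%N.

Definition is_tree (V : finType) (e : rel V) : Prop :=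
  connected_graph e /\ acyclic e.

Definition negative_edges (G : signed_graph) : {set {set 'I_(nvert G)}} :=
  [set [set p.1; p.2] | p : 'I_(nvert G) * 'I_(nvert G) & weight G p.1 p.2 < 0].

Definition expmx (K : numFieldType) (n : nat) (A : 'M[K]_n) : 'M[K]_n :=
  lim (series (fun k => (k`!%:R)^-1 *: A ^+ k) @ \oo)%classic.

Section quantum_walk.
Variable R : realType.

Definition adjacency_mx (G : signed_graph) : 'M[R[i]]_(nvert G) :=
  \matrix_(a, b) (weight G a b)%:~R.

Definition transition_mx (n : nat) (A : 'M[R[i]]_n) (t : R) : 'M[R[i]]_n :=
  expmx (('i%C * t%:C) *: A).

Definition sedentary (n : nat) (A : 'M[R[i]]_n) (u : 'cV[R[i]]_n) : Prop :=
  (u ^t* )%sesqui *m u = 1%:M /\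
  exists C : R, 0 < C <= 1 /\
    C <= inf [set ComplexField.Normc.normc (((u ^t* )%sesqui *m transition_mx A t *m u) 0 0)
             | t in [set t : R | 0 < t]]%classic.

Definition plus_state (n : nat) (a b : 'I_n) : 'cV[R[i]]_n :=
  (Num.sqrt 2)^-1%:C *: (delta_mx a 0 + delta_mx b 0).

Definition has_sedentary_plus_state (G : signed_graph) : Prop :=
  exists a b : 'I_(nvert G),
    a != b /\ sedentary (adjacency_mx G) (plus_state a b).

End quantum_walk.

(* Main.v *)
Require Import Defs.
From mathcomp Require Import all_boot all_order all_algebra.
From mathcomp Require Import all_classical all_reals all_analysis.
From mathcomp Require Import complex zify.

(* Two leaves a, b hanging from the same vertex c by edges of opposite signs
   satisfy A (e_a + e_b) = e_c - e_c = 0. The plus state on a, b is then fixed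
   by U(t) for all t, hence sedentary with C = 1. Trees of maximum degree k with
   such a pair of leaves are obtained by hanging a path of any length from one
   leaf of a star with k leaves. *)

Set Implicit Arguments.
Unset Strict Implicit.
Unset Printing Implicit Defensive.
Import Order.TTheory GRing.Theory Num.Theory.
Import numFieldNormedType.Exports.
Local Open Scope complex_scope.
Local Open Scope ring_scope.

(** * Convergence of the matrix exponential and its action on a kernel vector *)

Section matrix_exponential.
Local Open Scope classical_set_scope.
Variable R : realType.
Local Notation C := (Num.NumField.sort (R[i] : numFieldType)).
Local Notation normc := (@ComplexField.Normc.normc R).
Local Notation Re := (@complex.Re R).
Local Notation Im := (@complex.Im R).

Lemma normcE (z : R[i]) : `|z| = (normc z)%:C.
Proof. by rewrite normc_def; case: z. Qed.

Lemma normc_ge0 (z : R[i]) : 0 <= normc z.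
Proof. by rewrite -lecR -normcE; exact: normr_ge0. Qed.

Lemma le_normc_ReIm (z : R[i]) : normc z <= `|Re z| + `|Im z|.
Proof.
have -> : normc z = Num.sqrt (Re z ^+ 2 + Im z ^+ 2) by case: z.
rewrite -[leRHS]ger0_norm ?addr_ge0// -sqrtr_sqr ler_sqrt ?sqr_ge0//.
rewrite sqrrD !real_normK ?num_real// addrAC lerDl.
by rewrite mulrn_wge0// mulr_ge0.
Qed.

Lemma norm_Re_le (z : R[i]) : `|Re z| <= normc z.
Proof. by rewrite -lecR -normcE; exact: normc_ge_Re. Qed.

Lemma norm_Im_le (z : R[i]) : `|Im z| <= normc z.
Proof.
have -> : normc z = Num.sqrt (Re z ^+ 2 + Im z ^+ 2) by case: z.
by rewrite -sqrtr_sqr ler_wsqrtr// lerDr sqr_ge0.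
Qed.

Lemma is_cvg_complex (f : nat -> C) :
  cvgn (Re \o f) -> cvgn (Im \o f) -> cvgn f.
Proof.
move=> /cvg_ex[a fa] /cvg_ex[b fb]; apply/cvg_ex; exists (a +i* b : C).
(* The radius is itself complex; in the order on [R[i]] its positivity forces a zero imaginary part,
   so the real number [e] remains. *)
apply/cvgrPdist_lt => -[e e']; rewrite ltcE /= => /andP[/eqP -> e0].
have e20 : 0 < e / 2 by rewrite divr_gt0.
near=> n; rewrite normcE ltcR.
apply: le_lt_trans (le_normc_ReIm _) _; rewrite !raddfB /= [ltRHS]splitr ltrD//.
  by near: n; move/cvgrPdist_lt : fa; exact.
by near: n; move/cvgrPdist_lt : fb; exact.
Unshelve. all: by end_near. Qed.

(** Absolute convergence, reduced to real series: the moduli dominate both the real and the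
    imaginary parts. *)
Lemma is_cvg_series_complex (u : nat -> C) :
  cvgn (series (normc \o u)) -> cvgn (series u).
Proof.
have Re_series : Re \o series u = series (Re \o u).
  by apply/funext => n; rewrite /series /= raddf_sum.
have Im_series : Im \o series u = series (Im \o u).
  by apply/funext => n; rewrite /series /= raddf_sum.
move=> cu; apply: is_cvg_complex; rewrite ?Re_series ?Im_series.
  apply: normed_cvg; apply: series_le_cvg cu => n //=.
    exact: normc_ge0.
  exact: norm_Re_le.
apply: normed_cvg; apply: series_le_cvg cu => n //=.
  exact: normc_ge0.
exact: norm_Im_le.
Qed.

Lemma is_cvg_mx m n (f : nat -> 'M[C]_(m, n)) :
  (forall i j, cvgn (fun k => f k i j)) -> cvgn f.
Proof.
move=> fc; apply/cvg_ex.
exists (\matrix_(i, j) lim ((fun k => f k i j) @ \oo)).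
apply/cvg_ballP => e e0.
(* There are finitely many entries, so their eventual bounds hold simultaneously. *)
have : \forall k \near \oo, forall ij : 'I_m * 'I_n,
    ball (lim ((fun k => f k ij.1 ij.2) @ \oo)) e (f k ij.1 ij.2).
  apply: filter_forall => ij; have /cvg_ballP := fc ij.1 ij.2; exact.
apply: filterS => k fk; split=> // i j; rewrite mxE; exact: (fk (i, j)).
Qed.

(** An entry of [A * A ^+ k] is a sum of [n] products, each of modulus at most
    [c * (n%:R * c) ^+ k]. *)
Lemma normc_mx_exp_le n (A : 'M[C]_n) (c : R) : 0 <= c ->
  (forall i j, normc (A i j) <= c) ->
  forall k i j, normc ((A ^+ k) i j) <= (n%:R * c) ^+ k.
Proof.
move=> c0 Ac; elim=> [|k IH] i j.
  rewrite !expr0 mxE.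
  case: eqP => _; first by rewrite ComplexField.Normc.normc1.
  by rewrite ComplexField.Normc.normc0.
rewrite exprS mxE -lecR -normcE (le_trans (ler_norm_sum _ _ _))//.
rewrite (eq_bigr (fun l => (normc (A i l * (A ^+ k) l j))%:C)); last first.
  by move=> l _; exact: normcE.
rewrite -rmorph_sum lecR.
rewrite (@le_trans _ _ (\sum_(l < n) (c * (n%:R * c) ^+ k)))//.
  apply: ler_sum => l _; rewrite ComplexField.Normc.normcM.
  by rewrite ler_pM ?normc_ge0 ?Ac ?IH.
by rewrite sumr_const card_ord exprS -[leLHS]mulr_natl mulrA.
Qed.

(** Entry by entry, the series is dominated by the real exponential series at [n%:R * c], where [c]
    bounds the moduli of all entries of [A]. *)
Lemma is_cvg_expmx n (A : 'M[C]_n) :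
  cvgn (series (fun k => (k`!%:R)^-1 *: A ^+ k)).
Proof.
pose c := \sum_(i < n) \sum_(j < n) normc (A i j).
have Ac i j : normc (A i j) <= c.
  rewrite /c (bigD1 i)//= (bigD1 j)//= -addrA lerDl addr_ge0//.
    by apply: sumr_ge0 => l _; exact: normc_ge0.
  by apply: sumr_ge0 => l _; apply: sumr_ge0 => l' _; exact: normc_ge0.
have c0 : 0 <= c.
  by apply: sumr_ge0 => l _; apply: sumr_ge0 => l' _; exact: normc_ge0.
apply: is_cvg_mx => i j.
have -> : (fun k => series (fun k => (k`!%:R)^-1 *: A ^+ k) k i j) =
    series (fun k => (k`!%:R)^-1 * (A ^+ k) i j).
  apply/funext => N; rewrite /series /= summxE.
  by apply: eq_bigr => k _; rewrite mxE.
apply: is_cvg_series_complex.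
apply: series_le_cvg (is_cvg_series_exp_coeff (n%:R * c)) => k /=.
- exact: normc_ge0.
- by apply: exp_coeff_ge0; rewrite mulr_ge0.
rewrite ComplexField.Normc.normcM ComplexField.Normc.normcV mulrC /exp_coeff /=.
rewrite ler_pM ?invr_ge0 ?normc_ge0 ?normc_mx_exp_le//.
rewrite (_ : normc _ = k`!%:R) //.
by apply: (@complexI R); rewrite -normcE normr_nat rmorph_nat.
Qed.

Lemma mulmx_expr_ker n (A : 'M[C]_n) (v : 'cV[C]_n) k :
  A *m v = 0 -> A ^+ k.+1 *m v = 0.
Proof. by move=> Av; rewrite exprSr -[_ * _]/(_ *m _) -mulmxA Av mulmx0. Qed.

(** Only the identity term of the series acts nontrivially on [v]. Coordinates are continuous, so
    the limit can be compared with the eventually constant partial sums. *)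
Lemma expmx_ker n (A : 'M[C]_n) (v : 'cV[C]_n) :
  A *m v = 0 -> expmx A *m v = v.
Proof.
move=> Av; apply/colP => i.
pose S := series (fun k => (k`!%:R)^-1 *: A ^+ k).
have S_cvg : S @ \oo --> expmx A by exact: is_cvg_expmx.
have S_v : (fun N => (S N *m v) i 0) @ \oo --> (expmx A *m v) i 0.
  rewrite mxE (_ : (fun N => _) = fun N => \sum_j S N i j * v j 0); last first.
    by apply/funext => N; rewrite mxE.
  apply: cvg_big => [|j _]; first exact: add_continuous.
  apply: cvgM; last exact: cvg_cst.
  exact: (cvg_comp _ _ S_cvg (@coord_continuous C n n i j (expmx A))).
have S_const : (fun N => (S N *m v) i 0) @ \oo --> v i 0.
  (* The partial sum at 0 is empty; constancy starts at 1, once the identity term is included. *)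
  apply: cvg_near_cst; exists 1%N => // -[//|N] _ /=.
  rewrite /S /series /= mulmx_suml big_nat_recl//= big1 ?addr0.
    by rewrite fact0 invr1 scale1r expr0 mul1mx.
  by move=> k _; rewrite -scalemxAl mulmx_expr_ker// scaler0.
exact: (cvg_unique (@norm_hausdorff _ _) S_v S_const).
Qed.

End matrix_exponential.

(** * Opposite-sign twins give a sedentary plus state *)

Section twins.
Local Open Scope classical_set_scope.
Variable R : realType.

(** Columns [a] and [b] of the adjacency matrix cancel. The case [c = a] of the hypothesis, with
    looplessness, makes [a] and [b] nonadjacent. *)
Lemma twins_adjacency_ker (G : signed_graph) (a b : 'I_(nvert G)) :
  (forall c, weight G c a = - weight G c b) ->
  adjacency_mx R G *m plus_state R a b = 0.
Proof.
move=> twin; rewrite /plus_state -scalemxAr mulmxDr -!colE.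
apply/colP => c; rewrite !mxE twin.
by rewrite mulrNz addNr mulr0.
Qed.

Lemma plus_state_unit n (a b : 'I_n) : a != b ->
  ((plus_state R a b) ^t* )%sesqui *m plus_state R a b = 1%:M.
Proof.
move=> ab; apply/matrixP => i j; rewrite !ord1 !mxE.
rewrite (bigD1 a)//= (bigD1 b) 1?eq_sym//=.
rewrite big1 => [|c /andP[ca cb]]; last first.
  by rewrite !mxE (negPf ca) (negPf cb) addr0 !mulr0.
rewrite !mxE !eqxx (negPf ab) eq_sym (negPf ab) /= !addr0 ?add0r !mulr1.
rewrite -[Num.conj _]/(_^*%C) conjc_real -rmorphM -rmorphD /=.
by rewrite -invfM -expr2 sqr_sqrtr// -mulr2n -[_ *+ 2]mulr_natr mulVf.
Qed.

Lemma twins_sedentary (G : signed_graph) (a b : 'I_(nvert G)) : a != b ->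
  (forall c, weight G c a = - weight G c b) -> has_sedentary_plus_state R G.
Proof.
move=> ab twin; exists a, b; split=> //; split; first exact: plus_state_unit.
exists 1; split; first by rewrite ltr01 lexx.
(* The return amplitude has modulus 1 at every time, so the infimum is taken over a singleton. *)
rewrite (_ : [set _ | _ in _] = [set 1]) ?inf1//.
have fixed t : ComplexField.Normc.normc
    ((((plus_state R a b) ^t* )%sesqui *m transition_mx (adjacency_mx R G) t
      *m plus_state R a b) 0 0) = 1.
  rewrite -mulmxA expmx_ker ?plus_state_unit//.
    by rewrite mxE eqxx ComplexField.Normc.normc1.
  by rewrite -scalemxAl twins_adjacency_ker// scaler0.
apply/seteqP; split=> [_ [t _ <-]|_ ->] /=; first exact: fixed.
by exists 1; [exact: ltr01|exact: fixed].
Qed.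

End twins.

(** * Trees on an initial segment of the integers, given by a parent function *)

Section parent_tree.
Variables (p : nat -> nat) (n : nat).

(** The strict comparisons orient each edge from parent to child and exclude loops, even where [p]
    has a fixed point such as the root. Taking [p] on all of [nat] lets one function serve every
    size. *)
Definition parent_rel : rel 'I_n.+1 := fun a b =>
  ((a < b)%N && (a == p b :> nat)) || ((b < a)%N && (b == p a :> nat)).

Lemma parent_rel_sym : symmetric parent_rel.
Proof. by move=> a b; rewrite /parent_rel orbC. Qed.

Lemma parent_rel_connected :
  (forall v, 0 < v -> p v < v)%N -> connected_graph parent_rel.
Proof.
move=> p_lt.
have root_v v : connect parent_rel ord0 v.
  (* Strong induction descends the chain of parents to the root. *)
  case: v => v; elim/ltn_ind: v => v IH v_lt; case: (posnP v) => [v0|v0].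
    by rewrite (_ : Ordinal v_lt = ord0) ?connect0//; apply/val_inj.
  have pv_lt : (p v < n.+1)%N by exact: ltn_trans (p_lt v v0) v_lt.
  apply: connect_trans (IH _ (p_lt v v0) pv_lt) (connect1 _).
  by rewrite /parent_rel /= p_lt// eqxx.
split=> [|a b]; first by rewrite card_ord.
apply: connect_trans (root_v b).
by rewrite (sym_connect_sym parent_rel_sym) root_v.
Qed.

(* In a cycle of length at least three, the largest vertex would have two
   distinct smaller neighbours, hence two parents. *)
Lemma parent_rel_acyclic : acyclic parent_rel.
Proof.
move=> c; rewrite leqNgt; apply: contraPN => c_gt2 /andP[c_cycle c_uniq].
have [x0 x0c] : exists x0, x0 \in c.
  by case: c c_gt2 {c_cycle c_uniq} => // x *; exists x; exact: mem_head.
have [v vc v_max] := @arg_maxnP _ x0 (mem c) val x0c.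
(* Once the cycle is rotated to start at [v], the neighbours of [v] are its second and last
   vertices. *)
have [i s c_rot] := rot_to vc.
move: c_cycle c_uniq; rewrite -(rot_cycle i) -(rot_uniq i) c_rot.
have s_le w : w \in s -> (w <= v)%N.
  by move=> ws; apply: v_max; rewrite inE -(mem_rot i) c_rot inE ws orbT.
have : (1 < size s)%N by move: c_gt2; rewrite -(size_rot i) c_rot.
case: s s_le {c_rot} => [//|x s]; case/lastP: s => [//|s y] s_le _.
rewrite /= rcons_path last_rcons => /and3P[vx _ yv] /andP[_ /andP[]].
have /s_le xv : x \in x :: rcons s y by rewrite mem_head.
have /s_le yv' : y \in x :: rcons s y by rewrite inE mem_rcons mem_head orbT.
move: vx yv; rewrite /parent_rel !(ltnNge v) xv yv' /= orbF.
move=> /andP[_ /eqP xp] /andP[_ /eqP yp].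
by rewrite (_ : x = y) ?mem_rcons ?mem_head//; apply/val_inj; rewrite /= xp yp.
Qed.

End parent_tree.

(* A broom: the root 0 has the children 1, ..., k, and a path of length m hangs
   from k. The edge to the leaf 2 is the negative one. *)
Definition broom_parent (k v : nat) : nat := if (v <= k)%N then 0%N else v.-1.

(** With [minn] and [maxn] symmetry is immediate: the larger endpoint is the child, and it alone
    determines the sign of the edge. *)
Definition broom_weight (k u v : nat) : int :=
  if (minn u v < maxn u v)%N && (minn u v == broom_parent k (maxn u v))
  then (-1) ^+ (maxn u v == 2%N) else 0.

(** * Tree structure, degrees, negative edge and twin leaves of the broom *)

Section broom.
Variables k m : nat.

Lemma broom_weight_sym u v : broom_weight k u v = broom_weight k v u.
Proof. by rewrite /broom_weight minnC maxnC. Qed.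

Lemma broom_weight_loopless u : broom_weight k u u = 0.
Proof. by rewrite /broom_weight minnn maxnn ltnn. Qed.

Lemma broom_weight_unit u v : broom_weight k u v \in [:: 0; 1; -1].
Proof. by rewrite /broom_weight; case: ifP => //; case: (_ == 2%N). Qed.

Definition broom : signed_graph :=
  @SignedGraph (k + m).+1 (fun a b => broom_weight k a b)
    (fun a b => broom_weight_sym a b) (fun a => broom_weight_loopless a)
    (fun a b => broom_weight_unit a b).

Lemma underlying_broom :
  underlying broom =2 parent_rel (broom_parent k) (n := k + m).
Proof.
move=> a b; rewrite /underlying /parent_rel /= /broom_weight.
case: (ltngtP a b) => [ab|ba|ab].
- by rewrite ab orbF /=; case: ifP => // _; case: (val b == 2%N).
- by rewrite ba /=; case: ifP => // _; case: (val a == 2%N).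
- by rewrite ltnn.
Qed.

Lemma broom_parent_lt v : (0 < v -> broom_parent k v < v)%N.
Proof.
move=> v0; rewrite /broom_parent.
by case: (leqP v k) => // _; rewrite ltn_predL.
Qed.

Lemma broom_is_tree : is_tree (underlying broom).
Proof.
rewrite (_ : underlying broom = parent_rel (broom_parent k) (n := k + m)).
  split; last exact: parent_rel_acyclic.
  by apply: parent_rel_connected; exact: broom_parent_lt.
by apply/funext => a; apply/funext => b; exact: underlying_broom.
Qed.

Hypothesis k_ge3 : (3 <= k)%N.

Lemma broom_root_degree : #|[set b | underlying broom ord0 b]| = k.
Proof.
pose f (i : 'I_k) : 'I_(nvert broom) := inord i.+1.
have fE i : f i = i.+1 :> nat by rewrite inordK// ltnS; have := ltn_ord i; lia.
rewrite -[RHS]card_ord -(card_imset (f := f)); last first.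
  by move=> i j /(congr1 val); rewrite /= !fE => -[/val_inj].
apply: eq_card => b; rewrite inE underlying_broom /parent_rel /= orbF.
apply/andP/imsetP => [[b0 /eqP]|[i _ ->]].
  (* Beyond [k] the parent of [b] is [b.-1], which vanishes for positive [b] only at [b = 1], and 1
     is not beyond [k]. *)
  rewrite /broom_parent; case: leqP => b_k b_p; last by lia.
  have {}b0 : (0 < b)%N := b0.
  have b1_lt : (b.-1 < k)%N by rewrite prednK.
  by exists (Ordinal b1_lt) => //; apply: val_inj; rewrite /= fE prednK.
by rewrite fE /broom_parent ltn_ord.
Qed.

Lemma broom_degree_le a : (#|[set b | underlying broom a b]| <= k)%N.
Proof.
have [a0|a0] := posnP a.
  by rewrite (_ : a = ord0) ?broom_root_degree//; apply: val_inj.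
apply: leq_trans (ltnW k_ge3).
(* A child of a nonroot vertex lies beyond [k], where the parent is the predecessor, so it can only
   be [a.+1]. If [a.+1] is out of range, [inord] returns 0, which is harmless in an upper bound. *)
have sub : [set b | underlying broom a b] \subset
    [set inord (broom_parent k a); inord a.+1].
  apply/fintype.subsetP => b; rewrite !inE underlying_broom => /orP[]/andP[ab /eqP abE].
    apply/orP; right; rewrite -val_eqE/= inordK; last first.
      exact: leq_ltn_trans ab (ltn_ord b).
    by move: abE; rewrite /broom_parent; case: (leqP b k) => _ abE;
      [rewrite abE in a0 | rewrite abE prednK// (leq_ltn_trans _ ab)].
  by apply/orP; left; rewrite -val_eqE/= -abE inord_val.
by apply: leq_trans (subset_leq_card sub) _; rewrite cards2; case: (_ != _).
Qed.

Lemma max_degree_broom : max_degree (underlying broom) = k.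
Proof.
apply/eqP; rewrite eqn_leq; apply/andP; split.
  by apply/bigmax_leqP => a _; exact: broom_degree_le.
rewrite -[leqLHS]broom_root_degree.
exact: (leq_bigmax (F := fun a => #|[set b | underlying broom a b]|)).
Qed.

Lemma broom_weight_lt0 u v :
  (broom_weight k u v < 0) =
  (u == 0%N) && (v == 2%N) || (u == 2%N) && (v == 0%N).
Proof.
rewrite /broom_weight /broom_parent.
(* Replacing the sign by booleans leaves pure arithmetic on [minn] and [maxn]: the child is 2, and
   its parent is 0 because 2 is at most [k]. *)
have sign_lt0 (c d : bool) :
    ((if c then (-1) ^+ d else 0 : int) < 0) = c && d by case: c; case: d.
rewrite sign_lt0; case: (leqP (maxn u v) k); lia.
Qed.

Lemma card_negative_edges_broom : #|negative_edges broom| = 1%N.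
Proof.
have two : (inord 2 : 'I_(k + m).+1) = 2%N :> nat by rewrite inordK//; lia.
rewrite (_ : negative_edges broom = [set [set ord0; inord 2]]) ?cards1//.
(* The two ordered pairs of negative weight, (0, 2) and (2, 0), yield the same unordered edge. *)
apply/setP => X; rewrite inE; apply/imsetP/eqP => [[[a b]]|->].
  rewrite inE /= broom_weight_lt0 => /orP[]/andP[/eqP a_eq /eqP b_eq] ->.
    by congr [set _; _]; apply: val_inj; rewrite /= ?two.
  by rewrite finset.setUC; congr [set _; _]; apply: val_inj; rewrite /= ?two.
by exists (ord0, inord 2) => //; rewrite inE /= broom_weight_lt0 two.
Qed.

(** At the root the weights are 1 and -1. Elsewhere both vanish: since [k] is at least 3, the path
    hangs from a vertex other than 1 and 2, which are therefore leaves. *)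
Lemma broom_weight_twins u : broom_weight k u 1 = - broom_weight k u 2.
Proof.
rewrite /broom_weight.
have [->|u0] := posnP u.
  by rewrite !min0n !max0n /broom_parent /= (ltnW (ltnW k_ge3)) (ltnW k_ge3).
rewrite !ifF ?oppr0//.
  by rewrite /broom_parent; case: (leqP (maxn u 2) k); lia.
by rewrite /broom_parent; case: (leqP (maxn u 1) k); lia.
Qed.

Lemma broom_sedentary (R : realType) : has_sedentary_plus_state R broom.
Proof.
have one : (inord 1 : 'I_(k + m).+1) = 1%N :> nat by rewrite inordK//; lia.
have two : (inord 2 : 'I_(k + m).+1) = 2%N :> nat by rewrite inordK//; lia.
apply: (@twins_sedentary R broom (inord 1) (inord 2)).
  by rewrite -val_eqE /= one two.
by move=> c; rewrite /= one two broom_weight_twins.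
Qed.

End broom.

(** * Infinitely many isomorphism classes, and the conclusion *)

Lemma sg_isomorphic_nvert G H : sg_isomorphic G H -> nvert G = nvert H.
Proof. by move=> [f /bij_eq_card]; rewrite !card_ord. Qed.

(** The family is indexed by the path length [m]; the vertex count [(k + m).+1] separates its
    members up to isomorphism. *)
Lemma infinitely_many_sedentary_trees (R : realType) (k : nat) : (3 <= k)%N ->
  infinitely_many (fun T : signed_graph =>
    [/\ is_tree (underlying T),
        max_degree (underlying T) = k,
        #|negative_edges T| = 1%N
      & has_sedentary_plus_state R T]).
Proof.
move=> k_ge3; exists (broom k); split=> [m|i j].
  split; [exact: broom_is_tree | exact: max_degree_broom
    | exact: card_negative_edges_broom | exact: broom_sedentary].
by apply: contra_neq_not => /sg_isomorphic_nvert /= [] /addnI.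
Qed.

Theorem theorem7p8 (R : realType) :
  (forall k : nat, (3 <= k)%N ->
     infinitely_many (fun G : signed_graph =>
       [/\ connected_graph (underlying G),
           max_degree (underlying G) = k,
           #|negative_edges G| = 1%N
         & has_sedentary_plus_state R G])) /\
  infinitely_many (fun T : signed_graph =>
    [/\ is_tree (underlying T),
        max_degree (underlying T) = 3%N,
        #|negative_edges T| = 1%N
      & has_sedentary_plus_state R T]).
Proof.
split=> [k k_ge3|]; last exact: infinitely_many_sedentary_trees.
(* Trees are connected, so the same family proves the claim for graphs. *)
have [G [G_tree G_noniso]] := infinitely_many_sedentary_trees R k_ge3.
exists G; split=> // i; have [[G_conn _] G_deg G_neg G_sed] := G_tree i.
by split.
Qed.
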